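(* Let $n \ge 1$, let $G$ be a subgroup of the symmetric group $S_n$, and let $C$ be a coset of $G$ in $S_n$. If $$\frac{|\{\sigma\in C : \sigma \text{ has no fixed points}\}|}{|C|}=\frac{|\{\sigma\in S_n : \sigma \text{ has no fixed points}\}|}{|S_n|},$$ then $G=C=S_n$.
   Context: $S_n$ is the group of permutations of $\{1,\dots,n\}$. A permutation $\sigma$ has no fixed points if $\sigma(i)\ne i$ for all $i\in\{1,\dots,n\}$. *)

(* Defs.v *)
From mathcomp Require Import all_boot all_order all_fingroup all_algebra.

Set Implicit Arguments.
Unset Strict Implicit.
Unset Printing Implicit Defensive.

Definition fixed_point_free (n : nat) (s : 'S_n) : bool :=
  [forall i, s i != i].

Definition fpf_proportion (n : nat) (A : {set 'S_n}) : rat :=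
  (#|[set s in A | fixed_point_free s]|%:R / #|A|%:R)%R.

(* Main.v *)
Require Import Defs.
From mathcomp Require Import all_boot all_order all_fingroup all_algebra.
From mathcomp Require Import all_solvable.
From mathcomp Require Import zify ring.

Set Implicit Arguments.
Unset Strict Implicit.
Unset Printing Implicit Defensive.

(** Let [m] be the index of [G] and [D] the number of derangements of [n] points.
    The hypothesis gives [m %| D] and [m %| n`!].  As [D] is, up to sign, the sum
    of the [(-1)^j n(n-1)...(n-j+1)], its residue modulo [n - r] only depends on
    [r]; hence [m] is prime to [n], to the odd part of [n - 2] and of [n - 3], and
    [n - 4] contributes at most the prime 3.  For each prime [q] not dividing [m],
    Sylow's theorem puts a conjugate of every [q]-element of [S_n] into [G].

    So [G] is transitive.  A block system with [b] blocks of size [d] must satisfy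
    [b < q] unless [d] is a power of [q], since large [q]-power cycles preserve no
    other block system; this forces [n] to be a prime power, and an element of
    order [q] with exactly 2 or 3 fixed points excludes all cases but [n = 4].
    When [G] is primitive and contains a [q]-cycle with [2q <= n + 1], Jordan's
    theorem makes [G] [q]-transitive; two [q]-cycles of [G] meeting in one point
    then have a 3-cycle as commutator, and [G] contains [A_n].  Such a [q] exists
    unless [n <= 3] or [n = 7]; [n = 4] and [n = 7] need an extra count.  Finally
    [A_n] itself is excluded because the numbers of even and odd derangements
    differ by [det (J - I)], where [J] is the all-ones matrix, and this determinant
    is nonzero. *)

Import GRing.Theory Num.Theory.

(** * Divisibility and parity of derangement numbers *)

Definition alt_ffact_sum (n : nat) : int :=
  (\sum_(j < n.+1) (-1) ^+ j * (n ^_ j)%:Z)%R.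

Lemma card_perm_fix (T : finType) (J : {set T}) :
  #|[set s : {perm T} | [forall i in J, s i == i]]| = (#|T| - #|J|)`!.
Proof.
rewrite -(cardsC J) addKn -card_perm; apply: eq_card => s; rewrite inE.
apply/forall_inP/subsetP => [fixJ i | onJ i Ji].
  by rewrite !inE; apply: contra => /fixJ.
by apply: contraLR (Ji) => /(onJ i); rewrite inE.
Qed.

(** Inclusion-exclusion: the indicator of a derangement is the product of the [1 - [s i = i]],
    expanded over the sets [J] of points required to be fixed. *)
Lemma card_fpf (n : nat) :
  (#|[set s : 'S_n | fixed_point_free s]|%:Z = (-1) ^+ n * alt_ffact_sum n)%R.
Proof.
have fpfE (s : 'S_n) :
    ((fixed_point_free s)%:R = \prod_i (- (s i == i)%:R + 1) :> int)%R.
  case: (boolP (fixed_point_free s)) => [/forallP fs | /forallPn[i]].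
    by rewrite big1 // => i _; rewrite (negPf (fs i)) oppr0 add0r.
  by rewrite negbK => si; rewrite (bigD1 i) //= si addNr mul0r.
have prodE (s : 'S_n) (J : {set 'I_n}) :
    (\prod_i (if i \in J then - (s i == i)%:R else 1) =
      (-1) ^+ #|J| * (s \in [set s : 'S_n | [forall i in J, s i == i]])%:R :> int)%R.
  rewrite -big_mkcond /= prodrN inE; congr (_ * _)%R.
  case: (boolP [forall i in J, s i == i]) => [/forall_inP Js | /forall_inPn[i Ji /negPf si]].
    by rewrite big1 // => i /Js ->.
  by rewrite (bigD1 i) //= si mul0r.
transitivity (\sum_(J : {set 'I_n}) (-1) ^+ #|J| * ((n - #|J|)`!)%:R : int)%R.
  rewrite -natz -sum1_card big_mkcond natr_sum /=.
  under eq_bigr => s _.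
    have ->: ((if s \in [set s0 : 'S_n | fixed_point_free s0] then 1 else 0)%N%:R
              = (fixed_point_free s)%:R :> int)%R.
      by rewrite inE; case: ifP.
    rewrite fpfE bigA_distr.
    under eq_bigr => J _ do rewrite prodE.
    over.
  rewrite exchange_big /=; apply: eq_bigr => J _.
  rewrite -mulr_sumr; congr (_ * _)%R.
  have := card_perm_fix J; rewrite card_ord => <-.
  rewrite -sum1_card natr_sum [RHS]big_mkcond /=.
  by apply: eq_bigr => s _; case: (s \in _).
(* The ['C(n, j)] sets of size [n - j] contribute [j!] each, in total [n ^_ j]; hence the reversal
   of the index. *)
rewrite (partition_big (fun J : {set 'I_n} => inord #|J| : 'I_n.+1) xpredT) //=.
rewrite (reindex_inj rev_ord_inj) mulr_sumr /=; apply: eq_bigr => j _.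
have jn : j <= n by rewrite -ltnS.
rewrite (eq_bigl [in [set A : {set 'I_n} | #|A| == n - j]]) => [|A]; last first.
  by rewrite inE -val_eqE /= inordK // ltnS -[n in leqRHS]card_ord max_card.
rewrite (eq_bigr (fun=> (-1) ^+ (n - j) * (j`!)%:R)%R) => [|A]; last first.
  by rewrite inE => /eqP ->; rewrite subKn.
rewrite sumr_const card_draws card_ord bin_sub // -bin_ffact mulrA -exprD.
rewrite -signr_odd -[in RHS]signr_odd oddD oddB // -mulrnAr -mulrnA.
by rewrite mulnC natz.
Qed.

(** The factors [n - i] and [r - i] agree modulo [n - r]; once [j > r], the left side contains the
    factor [n - r] and the right side is 0. *)
Lemma ffact_mod (n r j : nat) : r <= n -> n ^_ j = r ^_ j %[mod n - r].
Proof.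
elim: j n r => [|j IHj] n r le_rn; first by rewrite !ffactn0.
case: r le_rn => [|r] le_rn; first by rewrite subn0 !ffactnS mul0n modnMr mod0n.
case: n le_rn => [|n] // le_rn; rewrite !ffactnS /= subSS -modnMm IHj // modnMm.
by rewrite -{1}(subnK le_rn) subSS mulnDl [(n - r) * _]mulnC modnMDl.
Qed.

Lemma alt_ffact_sum_mod (n r q : nat) : r <= n -> q %| n - r ->
  (alt_ffact_sum n = alt_ffact_sum r %[mod q])%Z.
Proof.
move=> le_rn q_dv; apply/eqP; rewrite eqz_mod_dvd.
have ->: (alt_ffact_sum r = \sum_(j < n.+1) (-1) ^+ j * (r ^_ j)%:Z)%R.
  rewrite /alt_ffact_sum (big_ord_widen n.+1 (fun j => (-1) ^+ j * (r ^_ j)%:Z)%R) //.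
  rewrite big_mkcond /=; apply: eq_bigr => j _.
  by case: ltnP => // /ffact_small ->; rewrite mulr0.
rewrite /alt_ffact_sum -sumrB; apply: rpred_sum => j _.
rewrite -mulrBr; apply: dvdz_mull.
rewrite -eqz_mod_dvd !modz_nat eqz_nat.
by rewrite -(modn_dvdm _ q_dv) ffact_mod // modn_dvdm.
Qed.

Lemma dvdn_card_fpf (n r q : nat) : r <= n -> q %| n - r ->
  (q %| #|[set s : 'S_n | fixed_point_free s]|) = (q %| alt_ffact_sum r)%Z.
Proof.
move=> le_rn q_dv.
transitivity (q %| alt_ffact_sum n)%Z.
  by have /(congr1 absz) := card_fpf n; rewrite abszMsign dvdzE /= => ->.
apply/dvdz_mod0P/dvdz_mod0P => <-; last by rewrite (alt_ffact_sum_mod le_rn).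
by rewrite (alt_ffact_sum_mod le_rn).
Qed.

Lemma alt_ffact_sum_small :
  [/\ alt_ffact_sum 0 = 1, alt_ffact_sum 2 = 1, alt_ffact_sum 3 = - 2
    & alt_ffact_sum 4 = 9]%R.
Proof. by split; rewrite /alt_ffact_sum !big_ord_recr big_ord0. Qed.

(* [n - r] is used for [r] = 0, 2, 3, 4, where [alt_ffact_sum r] is 1, 1, -2, 9. *)
Definition good_prime (n q : nat) : bool :=
  prime q && [|| q %| n, [&& odd q, 2 <= n & q %| n - 2],
                 [&& odd q, 3 <= n & q %| n - 3] | [&& 3 < q, 4 <= n & q %| n - 4]].

Lemma good_prime_ndvdn_card_fpf (n q : nat) : good_prime n q ->
  ~~ (q %| #|[set s : 'S_n | fixed_point_free s]|).
Proof.
case: alt_ffact_sum_small => f0 f2 f3 f4 /andP[pr_q].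
have q_gt1 := prime_gt1 pr_q.
case/or4P => [qn | /and3P[oq n2 qn] | /and3P[oq n3 qn] | /and3P[q3 n4 qn]].
- by rewrite (@dvdn_card_fpf n 0) ?subn0 // f0 dvdzE /= dvdn1 neq_ltn q_gt1 orbT.
- by rewrite (dvdn_card_fpf n2 qn) f2 dvdzE /= dvdn1 neq_ltn q_gt1 orbT.
- rewrite (dvdn_card_fpf n3 qn) f3 dvdzE /=.
  by rewrite dvdn_prime2 //; apply: contraTneq oq => ->.
rewrite (dvdn_card_fpf n4 qn) f4 dvdzE -[`|9|%N]/(3 ^ 2) /=.
by rewrite Euclid_dvdX // andbT dvdn_prime2 //; case: eqP q3 => // ->.
Qed.

(** As [J^2 = n J], the product of [J - I] and [J - (n - 1) I] is the nonzero scalar [n - 1]. *)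
Lemma det_ones_sub_id (n : nat) : 1 < n ->
  (\det (const_mx (1 : rat) - 1%:M : 'M[rat]_n)%R != 0)%R.
Proof.
move=> n1; set J : 'M[rat]_n := const_mx (1 : rat)%R.
have JJ : (J *m J = n%:R *: J)%R.
  apply/matrixP=> i j; rewrite !mxE (eq_bigr (fun=> 1%R)) => [|k _].
    by rewrite sumr_const card_ord mulr1.
  by rewrite !mxE mulr1.
have inv : ((J - 1%:M) *m (J - (n%:R - 1)%:M) = (n%:R - 1)%:M)%R.
  rewrite mulmxBl mulmxBr JJ mul1mx mul_mx_scalar.
  by apply/matrixP=> i j; rewrite !mxE; case: (i == j); rewrite /=; ring.
have := congr1 determinant inv; rewrite det_mulmx det_scalar => eq_det.
apply/eqP=> det0; move/eqP: eq_det; rewrite det0 mul0r eq_sym expf_eq0.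
by rewrite subr_eq0 pnatr_eq1; case: n n1 {J JJ inv det0} => [|[|n]].
Qed.

(** In the Leibniz expansion of [det (J - I)] only derangements survive, each contributing its
    sign. *)
Lemma card_fpf_parity_neq (n : nat) (b : bool) : 1 < n ->
  #|[set s : 'S_n | fixed_point_free s]| <>
  #|[set s : 'S_n | (odd_perm s == b) && fixed_point_free s]|.*2.
Proof.
move=> n1 eqD; case/eqP: (det_ones_sub_id n1).
pose E c := [set s : 'S_n | (odd_perm s == c) && fixed_point_free s].
have eqE : #|E b| = #|E (~~ b)|.
  have : #|[set s : 'S_n | fixed_point_free s]| = #|E b| + #|E (~~ b)|.
    rewrite -cardsUI (_ : E b :&: E (~~ b) = set0) ?cards0 ?addn0; last first.
      by apply/setP=> s; rewrite !inE; case: (odd_perm s); case: b {eqD}; rewrite ?andbF.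
    congr #|pred_of_set _|; apply/setP=> s; rewrite !inE -andb_orl.
    by case: (odd_perm s); case: b {eqD}.
  by rewrite eqD -/(E b); lia.
have fpfE (s : 'S_n) : (\prod_i (const_mx (1 : rat) - 1%:M : 'M[rat]_n)%R i (s i) =
    (fixed_point_free s)%:R :> rat)%R.
  case: (boolP (fixed_point_free s)) => [/forallP fs | /forallPn[i]].
    by apply: big1 => i _; rewrite !mxE eq_sym (negPf (fs i)) subr0.
  by rewrite negbK => /eqP si; rewrite (bigD1 i) //= !mxE si eqxx subrr mul0r.
rewrite /determinant (eq_bigr _ (fun s _ => congr1 _ (fpfE s))).
have sumE c : (\sum_(s : 'S_n | odd_perm s == c) (-1) ^+ s * (fixed_point_free s)%:R =
    (-1) ^+ c * #|E c|%:R :> rat)%R.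
  rewrite -sum1_card natr_sum mulr_sumr big_mkcond [RHS]big_mkcond /=.
  apply: eq_bigr => s _; rewrite inE; case: eqP => //= ->.
  by case: fixed_point_free; rewrite ?mulr1 ?mulr0.
rewrite (bigID (fun s : 'S_n => odd_perm s == b)) /= sumE.
rewrite (eq_bigl (fun s : 'S_n => odd_perm s == ~~ b)) => [|s]; last first.
  by case: (odd_perm s); case: b {eqD eqE}.
by rewrite sumE -eqE -mulrDl; case: b {eqD eqE sumE}; rewrite ?addNr ?subrr mul0r.
Qed.

(** * Existence of a small good prime *)

Lemma not_pnat (p n : nat) : 0 < n -> ~~ p.-nat n ->
  exists q, [/\ prime q, q %| n & q != p].
Proof.
rewrite /pnat => -> /allPn[q]; rewrite mem_primes => /and3P[pr_q _ qn] qp.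
by exists q.
Qed.

(** No power of 3 is 7 modulo 8, so [2^k = 3^j + 1] forces [k <= 2]. *)
Lemma exp3_mod8 (j : nat) : (3 ^ j %% 8 == 1) || (3 ^ j %% 8 == 3).
Proof.
by elim: j => // j /orP[] /eqP IHj; rewrite expnS -modnMmr IHj.
Qed.

(** For odd [n], a composite [n] or [n - 2] offers its least prime factor. If both are prime and
    [n > 5], then 3 divides [n - 4], and a good [q] has [2q] dividing [n - 3] or [3q] dividing
    [n - 4], unless these are powers of 2 and of 3. *)
Lemma exists_good_prime (n : nat) : 3 < n -> n != 7 ->
  exists2 q, good_prime n q & q.*2 <= n.+1.
Proof.
move=> n3 n7; have [odd_n | even_n] := boolP (odd n); last first.
  by exists 2; [rewrite /good_prime /= dvdn2 even_n | lia].
have composite m : 1 < m -> odd m -> ~~ prime m ->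
    exists q, [/\ prime q, q %| m, odd q & q.*2 <= m].
  move=> m1 odd_m npr; exists (pdiv m); have q_dv := pdiv_dvd m.
  have pr_q := pdiv_prime m1; have odd_q := dvdn_odd q_dv odd_m.
  have q1 := prime_gt1 pr_q; split=> //.
  have : ~~ (m < pdiv m ^ 2) by apply: contra npr; apply: ltn_pdiv2_prime; apply: ltnW.
  by rewrite -leqNgt; move: odd_q q1; set q := pdiv m; case: q => [|[|[|q]]] //; nia.
have [pr_n | /composite[||q [pr_q q_dv odd_q le_q]]] := boolP (prime n); try lia; last first.
  by exists q; [rewrite /good_prime pr_q q_dv | lia].
have [pr_n2 | /composite[||q [pr_q q_dv odd_q le_q]]] := boolP (prime (n - 2));
  try lia; last first.
  by exists q; [rewrite /good_prime pr_q q_dv odd_q (ltnW (ltnW n3)) /= orbT | lia].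
have [n5 | n5] := eqVneq n 5; first by exists 3; rewrite n5.
have n8 : 8 < n.
  by case: n n3 n7 n5 odd_n {composite pr_n pr_n2} => [|[|[|[|[|[|[|[|[|]]]]]]]]].
have ndvd3 m : prime m -> 3 < m -> ~~ (3 %| m).
  by move=> pr_m m3; rewrite dvdn_prime2 // neq_ltn m3.
have n4_3 : 3 %| n - 4.
  by have := ndvd3 n pr_n n3; have := ndvd3 (n - 2) pr_n2 _; lia.
have [p2 | /not_pnat] := boolP (2.-nat (n - 3)); last first.
  case=> [|q [pr_q q_dv q2]]; first lia.
  have odd_q : odd q by case: (even_prime pr_q) => // q2'; rewrite q2' in q2.
  exists q; first by rewrite /good_prime pr_q q_dv odd_q (ltnW n3) /= !orbT.
  have : 2 * q %| n - 3 by rewrite Gauss_dvd ?q_dv ?coprime2n // andbT; lia.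
  by move/dvdn_leq; lia.
have [p3 | /not_pnat] := boolP (3.-nat (n - 4)); last first.
  case=> [|q [pr_q q_dv q3]]; first lia.
  have q2 : q != 2 by apply: contraTneq q_dv => ->; lia.
  have q4 : 3 < q by case: q pr_q q2 q3 {q_dv} => [|[|[|[|]]]].
  exists q; first by rewrite /good_prime pr_q q_dv q4 n3 !orbT.
  have : 3 * q %| n - 4.
    by rewrite Gauss_dvd ?q_dv ?n4_3 // prime_coprime // dvdn_prime2 // eq_sym.
  by move/dvdn_leq; lia.
have [k nk] := p_natP p2; have [j nj] := p_natP p3.
have [k2 | k3] := leqP k 2.
  by have := leq_pexp2l (isT : 0 < 2) k2; rewrite -nk -[2 ^ 2]/4; lia.
have : 8 %| n - 3 by rewrite nk -(subnKC k3) expnD dvdn_mulr.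
have := exp3_mod8 j; rewrite -nj; lia.
Qed.

Local Open Scope group_scope.

(** * Elements of prime power order and cycles *)

(** A Sylow [p]-subgroup of [G] is also Sylow in [H], so it contains a conjugate of [<[x]>]. *)
Lemma p_elt_conj_mem (gT : finGroupType) (H G : {group gT}) (p : nat) (x : gT) :
    G \subset H -> prime p -> ~~ (p %| #|H : G|) -> x \in H -> p.-elt x ->
  exists2 y, y \in H & x ^ y \in G.
Proof.
move=> sGH pr_p p'GH Hx px.
have [P sylP] := Sylow_exists p G.
have /andP[sPG /andP[pP p'P]] := sylP.
have sylPH : p.-Sylow(H) P.
  rewrite /pHall (subset_trans sPG sGH) pP /= -(Lagrange_index sGH sPG).
  by rewrite pnatM p'P andbT p'natE // p'GH indexg_gt0.
have [y Hy sub] := Sylow_subJ sylPH (etrans (cycle_subG _ _) Hx) px.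
exists y^-1; first by rewrite groupV.
rewrite (subsetP sPG) // -mem_conjg -cycle_subG //.
Qed.

(** The numbers of cosets and of cosets fixed by [<[x]>] agree modulo [p] and are both below [p], so
    every coset is fixed, [G] included. *)
Lemma p_elt_small_index (gT : finGroupType) (H G : {group gT}) (p : nat) (x : gT) :
    G \subset H -> #|H : G| < p -> x \in H -> p.-elt x -> x \in G.
Proof.
move=> sGH ltp Hx px.
have acts : [acts <[x]>, on rcosets G H | 'Rs].
  by apply: subset_trans (actsRs_rcosets G H); rewrite cycle_subG.
have := pgroup_fix_mod px acts; rewrite -/(#|H : G|) modn_small //.
rewrite modn_small => [eq|]; last first.
  by apply: leq_ltn_trans ltp; apply/subset_leq_card/subsetIl.
have defF : 'Fix_(rcosets G H | 'Rs)(<[x]>) = rcosets G H.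
  by apply/eqP; rewrite eqEcard subsetIl /= -eq.
have: G :* 1 \in rcosets G H by apply/rcosetsP; exists 1; rewrite ?group1.
rewrite -defF inE => /andP[_ /afixP/(_ x (cycle_id x))].
by rewrite /= rcosetE -rcosetM mul1g mulg1 => <-; rewrite rcoset_refl.
Qed.

Lemma cycle_perm_exists (T : finType) (A : {set T}) :
  exists s : {perm T}, perm_on A s /\ forall x, x \in A -> porbit s x = A.
Proof.
have Ue := enum_uniq A.
exists (perm (can_inj (prev_next Ue))); split.
  by apply/subsetP=> x; rewrite inE permE next_nth mem_enum; case: ifP; rewrite ?eqxx.
set s := perm _; move=> x Ax; apply/setP=> y; rewrite -(mem_enum A).
have cyc : fcycle s (enum A).
  by rewrite (eq_fcycle (f' := next (enum A))) ?cycle_next // => z; rewrite permE.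
rewrite -(fconnect_cycle cyc (x := x)) ?mem_enum //.
apply/porbitP/idP => [[i ->] | /iter_findex <-]; first by rewrite permX fconnect_iter.
by exists (findex s x y); rewrite permX.
Qed.
Lemma porbit_expg_fix (T : finType) (s : {perm T}) (x : T) (k : nat) :
  ((s ^+ k) x == x) = (#|porbit s x| %| k).
Proof.
set m := #|_|.
have fix_m (j : nat) : (s ^+ (j * m)) x = x.
  elim: j => [|j IHj]; first by rewrite expg0 perm1.
  by rewrite mulSn expgD permM [(s ^+ m) x]permX iter_porbit.
apply/eqP/idP => [fix_k | /dvdnP[j ->] //].
have m_gt0 : 0 < m by rewrite lt0n card_porbit_neq0.
have lt_r := ltn_pmod k m_gt0.
have : (s ^+ (k %% m)) x = x.
  by move: fix_k; rewrite {1}(divn_eq k m) expgD permM fix_m.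
rewrite /dvdn permX => fix_r.
have := uniq_traject_porbit s x; rewrite -/m.
move/(nth_uniq x); rewrite size_traject => /(_ _ _ lt_r m_gt0).
by rewrite !nth_traject // fix_r eqxx => <-.
Qed.

(** For the [G]-orbit [O] of [x], [|O| * |H : G| = |S| * |C_H[x] : C_G[x]|]; by coprimality [|S|]
    divides [|O|]. *)
Lemma coprime_index_transitive (aT : finGroupType) (rT : finType)
    (to : {action aT &-> rT}) (G H : {group aT}) (S : {set rT}) :
    G \subset H -> coprime #|S| #|H : G| -> [transitive H, on S | to] ->
  [transitive G, on S | to].
Proof.
move=> sGH co trH; have [x Sx defS] := imsetP trH.
have sOS : orbit to G x \subset S.
  by rewrite acts_sub_orbit // (subset_trans sGH) ?atrans_acts.
apply/imsetP; exists x => //; apply/eqP; rewrite eq_sym eqEcard sOS /=.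
apply: dvdn_leq; first by apply/card_gt0P; exists x; apply: orbit_refl.
rewrite -(Gauss_dvdl _ co); apply/dvdnP; exists #|'C_H[x | to] : 'C_G[x | to]|.
have sC : 'C_G[x | to] \subset 'C_H[x | to] by apply: setSI.
apply/eqP; rewrite -(eqn_pmul2r (cardG_gt0 'C_G[x | to])) mulnAC card_orbit_stab.
rewrite (Lagrange sGH) mulnAC [(#|_ : _| * _)%N]mulnC (Lagrange sC) mulnC.
by rewrite -(atransP trH x Sx) card_orbit_stab.
Qed.

Definition is_cycle_on (T : finType) (A : {set T}) (s : {perm T}) : Prop :=
  perm_on A s /\ {in A, forall x, porbit s x = A}.

Lemma is_cycle_onJ (T : finType) (A : {set T}) (s y : {perm T}) :
  is_cycle_on A s -> is_cycle_on (y @: A) (s ^ y).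
Proof.
case=> onA cyc; split.
  apply/subsetP=> x; rewrite inE -[x](permKV y) permJ (inj_eq perm_inj) => sx.
  by rewrite mem_imset ?(subsetP onA) //; apply: perm_inj.
move=> _ /imsetP[x Ax ->]; rewrite -(cyc x Ax); apply/setP=> z.
apply/porbitP/imsetP=> [[i ->] | [_ /porbitP[i ->] ->]].
  by exists ((s ^+ i) x); rewrite ?mem_porbit // -conjXg permJ.
by exists i; rewrite -conjXg permJ.
Qed.

Lemma is_cycle_on_order (T : finType) (A : {set T}) (s : {perm T}) :
  is_cycle_on A s -> s ^+ #|A| = 1.
Proof.
case=> onA cyc; apply/permP=> x; rewrite perm1; have [Ax|nAx] := boolP (x \in A).
  by rewrite -(cyc x Ax) permX iter_porbit.
by rewrite permX_fix // (out_perm onA).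
Qed.

Lemma exists_set_card (T : finType) (k : nat) :
  k <= #|T| -> exists A : {set T}, #|A| = k.
Proof.
rewrite -bin_gt0 -card_draws => /card_gt0P[A].
by rewrite inE => /eqP; exists A.
Qed.

Lemma prime_power_cycle_mem (T : finType) (G : {group {perm T}}) (p k : nat) :
    prime p -> ~~ (p %| #|[set: {perm T}] : G|) -> (p ^ k <= #|T|)%N ->
  exists (A : {set T}) (s : {perm T}), [/\ #|A| = (p ^ k)%N, s \in G & is_cycle_on A s].
Proof.
move=> pr_p p'G /exists_set_card[A cardA].
have [s cyc] := cycle_perm_exists A.
have ps : p.-elt s.
  apply: (@pnat_dvd _ (p ^ k)%N); last by rewrite pnatX pnat_id.
  by rewrite order_dvdn -cardA (is_cycle_on_order cyc).
have [y _ Gsy] := p_elt_conj_mem (subsetT G) pr_p p'G (in_setT s) ps.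
exists (y @: A), (s ^ y); split => //; last exact: is_cycle_onJ.
by rewrite card_imset //; apply: perm_inj.
Qed.

Lemma block_card (T : finType) (G : {group {perm T}}) (Q : {set {set T}})
    (B : {set T}) :
    partition Q setT -> [acts G, on Q | 'P^*] -> [transitive G, on setT | 'P] ->
    B \in Q ->
  {in Q, forall A : {set T}, #|A| = #|B|}.
Proof.
move=> /and3P[_ tiQ Q0] actQ trG QB A QA.
have /set0Pn[x Bx] : B != set0 by apply: contraNneq Q0 => <-.
have /set0Pn[y Ay] : A != set0 by apply: contraNneq Q0 => <-.
have [g Gg def_y] := atransP2 trG (in_setT x) (in_setT y).
have QBg : 'P^*%act B g \in Q by rewrite (actsP actQ).
rewrite -(card_setact 'P B g); congr #|pred_of_set _|.
rewrite -(def_pblock tiQ QA Ay); apply: def_pblock => //.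
by rewrite def_y; apply: imset_f.
Qed.

(* Either the cycle lies in one block, or no block meeting its support [A] contains
   a fixed point of [s], so that [A] is a union of blocks. *)
Lemma cycle_block_card (T : finType) (s : {perm T}) (A : {set T})
    (Q : {set {set T}}) (d : nat) :
    is_cycle_on A s -> partition Q setT -> {in Q, forall B : {set T}, #|B| = d} ->
    {in Q, forall B : {set T}, s @: B \in Q} ->
  #|A| <= d \/ d %| #|A|.
Proof.
move=> [onA cyc] /and3P[/eqP covQ tiQ Q0] cardQ actQ.
have inQ y : pblock Q y \in Q by rewrite pblock_mem // covQ.
have [/forall_inP sub | /forall_inPn[y Ay /subsetPn[z yz nAz]]] :=
    boolP [forall y in A, pblock Q y \subset A].
  right; apply/dvdnP; exists #|[set B in Q | B \subset A]|.
  apply: card_uniform_partition => [B | ]; first by rewrite inE => /andP[/cardQ].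
  apply/and3P; split; last by rewrite inE (negPf Q0).
    apply/eqP/setP=> x; apply/bigcupP/idP=> [[B] | Ax].
      by rewrite inE => /andP[_ /subsetP]; apply.
    by exists (pblock Q x); rewrite ?mem_pblock ?covQ // inE inQ sub.
  by apply: trivIsetS tiQ; apply/subsetP=> B; rewrite inE => /andP[].
left; rewrite -(cardQ _ (inQ y)); apply: subset_leq_card.
have fixB : s @: pblock Q y = pblock Q y.
  rewrite -(def_pblock tiQ (inQ y) yz); apply/esym/def_pblock => //.
    by rewrite actQ // (def_pblock tiQ (inQ y) yz).
  rewrite (def_pblock tiQ (inQ y) yz).
  by rewrite -(out_perm onA nAz); apply: imset_f.
rewrite -(cyc y Ay); apply/subsetP=> _ /porbitP[i ->].
elim: i => [|i IHi]; first by rewrite expg0 perm1 mem_pblock covQ.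
by rewrite expgSr permM -fixB imset_f.
Qed.

(** * Primitivity *)

(** Let [p ^ i <= d < p ^ i.+1]. A cycle of length [p ^ i.+1] in [G] is too long for one block, so
    [d] divides its length. If there are too few points for it, then
    [#|Q| * p ^ i <= #|T| < p ^ i.+1]. *)
Lemma block_power_or_few (T : finType) (G : {group {perm T}})
    (Q : {set {set T}}) (d p : nat) :
    partition Q setT -> [acts G, on Q | 'P^*] ->
    {in Q, forall B : {set T}, #|B| = d} -> 0 < d ->
    prime p -> ~~ (p %| #|[set: {perm T}] : G|) ->
  (exists i, d = p ^ i)%N \/ #|Q| < p.
Proof.
move=> partQ actQ cardQ d_gt0 pr_p p'G.
have cardT : #|T| = (#|Q| * d)%N by rewrite -cardsT (card_uniform_partition cardQ).
have [lo hi] := andP (trunc_log_bounds (prime_gt1 pr_p) d_gt0).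
set i := trunc_log p d in lo hi.
have [le|gt] := leqP (p ^ i.+1)%N #|T|; [left | right]; last first.
  rewrite -(@ltn_pmul2r (p ^ i)) ?expn_gt0 ?prime_gt0 // -expnS.
  by apply: leq_ltn_trans gt; rewrite cardT leq_mul2l lo orbT.
have [A [s [cardA Gs cyc]]] := prime_power_cycle_mem pr_p p'G le.
have actsQ : {in Q, forall B : {set T}, s @: B \in Q}.
  by move=> B QB; move: (actsP actQ s Gs B); rewrite QB.
case: (cycle_block_card cyc partQ cardQ actsQ); rewrite cardA.
  by rewrite leqNgt hi.
by case/(dvdn_pfactor _ _ pr_p) => j _ ->; exists j.
Qed.

(* An element of order [p] fixing [r] points stabilises each of the [#|Q| < p] blocks,
   and each block contains exactly [d %% p] of these points. *)
Lemma block_number_dvd (T : finType) (G : {group {perm T}})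
    (Q : {set {set T}}) (d p r : nat) :
    partition Q setT -> [acts G, on Q | 'P^*] ->
    {in Q, forall B : {set T}, #|B| = d} ->
    prime p -> ~~ (p %| #|[set: {perm T}] : G|) ->
    #|Q| < p -> r < p -> r < #|T| -> p %| #|T| - r ->
  #|Q| %| r.
Proof.
move=> partQ actQ cardQ pr_p p'G ltQp ltrp ltrT dv.
have [A cardA] := exists_set_card (leq_subr r #|T|).
have [c cyc] := cycle_perm_exists A.
have onA : perm_on A c by case: cyc.
(* This power of the cycle on [#|T| - r] points has order [p] and fixes exactly the other [r]
   points. *)
pose k := ((#|T| - r) %/ p)%N.
have kp : (k * p)%N = #|A| by rewrite cardA divnK.
have pc : p.-elt (c ^+ k).
  by apply: (@pnat_dvd _ p); rewrite ?pnat_id // order_dvdn -expgM kp (is_cycle_on_order cyc).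
have [y _ Gy] := p_elt_conj_mem (subsetT G) pr_p p'G (in_setT _) pc.
set h := (c ^+ k) ^ y in Gy.
have ph : p.-elt h by rewrite p_eltJ.
have A_gt0 : 0 < #|A| by rewrite cardA subn_gt0.
have fixc x : ((c ^+ k) x == x) = (x \notin A).
  have [Ax|nAx] := boolP (x \in A); last first.
    by rewrite permX_fix ?eqxx // (out_perm onA).
  rewrite porbit_expg_fix (proj2 cyc) // -kp; apply/negP=> /dvdn_leq.
  have := prime_gt1 pr_p; move: A_gt0; rewrite -kp; nia.
pose F := [set x | h x == x].
have cardF : #|F| = r.
  have -> : F = y @: (~: A).
    apply/setP=> x; rewrite inE -[x](permKV y) permJ (inj_eq perm_inj) fixc.
    by rewrite mem_imset ?inE //; apply: perm_inj.
  rewrite card_imset; last exact: perm_inj.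
  by have := cardsC A; rewrite cardA; lia.
have actB : [acts <[h]>, on Q | 'P^*].
  by apply: subset_trans actQ; rewrite cycle_subG.
have fixQ B : B \in Q -> 'P^*%act B h = B.
  have := pgroup_fix_mod ph actB; rewrite modn_small //.
  rewrite modn_small; last by apply: leq_ltn_trans ltQp; apply/subset_leq_card/subsetIl.
  move=> eq; have defF : 'Fix_(Q | 'P^*)(<[h]>) = Q.
    by apply/eqP; rewrite eqEcard subsetIl -eq /=.
  by rewrite -{1}defF inE => /andP[_ /afixP/(_ h (cycle_id h))].
have cardBF B : B \in Q -> #|B :&: F| = (d %% p)%N.
  move=> QB; have actsB : [acts <[h]>, on B | 'P].
    rewrite cycle_subG; apply/astabsP=> x.
    by rewrite -{1}(fixQ _ QB) (mem_imset (f := ('P)%act^~ h)) //; apply: act_inj.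
  have BF : 'Fix_(B | 'P)(<[h]>) = B :&: F.
    apply/setP=> x; rewrite in_setI [RHS]in_setI [in RHS]inE; congr (_ && _).
    apply/afixP/eqP => [/(_ h (cycle_id h)) // | hx _ /cycleP[i ->]].
    exact: permX_fix.
  have := pgroup_fix_mod ph actsB; rewrite cardQ // BF => ->.
  rewrite modn_small //; apply: leq_ltn_trans ltrp; rewrite -cardF.
  exact/subset_leq_card/subsetIr.
have : #|F| = (\sum_(B in Q) #|B :&: F|)%N.
  rewrite -sum1_card big_mkcond /= [LHS](eq_bigl [in setT]) => [|x]; last by rewrite inE.
  rewrite (set_partition_big _ partQ) /=; apply: eq_bigr => B _.
  by rewrite -big_mkcondr -sum1_card; apply: eq_bigl => x; rewrite in_setI.
rewrite (eq_bigr _ cardBF) sum_nat_const cardF => ->.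
exact: dvdn_mulr.
Qed.

Lemma prime_power_factors (b d : nat) : 1 < b -> 1 < d ->
    (forall p, prime p -> p %| b -> exists i, d = (p ^ i)%N) ->
  exists p k l, [/\ prime p, 0 < k, 0 < l, b = (p ^ k)%N & d = (p ^ l)%N].
Proof.
move=> b1 d1 Hd; have pr := pdiv_prime b1; set p := pdiv b in pr.
have [l dl] := Hd p pr (pdiv_dvd b).
have l0 : 0 < l by case: l dl d1 => // ->; rewrite expn0.
have pb : p.-nat b.
  apply/pnatP=> [|q pr_q qb]; first exact: ltnW.
  have [[|j] dj] := Hd q pr_q qb; first by rewrite dj in d1.
  have : q %| d by rewrite dj expnS dvdn_mulr.
  by rewrite dl Euclid_dvdX // dvdn_prime2 // => /andP[].
have [k bk] := p_natP pb.
by exists p, k, l; split=> //; case: k bk b1 => // ->; rewrite expn0.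
Qed.

(** A prime factor of the number of blocks does not exceed that number, so the block size is a power
    of it; hence both numbers are powers of one prime [p]. *)
Lemma good_index_primitive (T : finType) (G : {group {perm T}}) :
    (forall q, good_prime #|T| q -> ~~ (q %| #|[set: {perm T}] : G|)) ->
    [transitive G, on setT | 'P] -> #|T| != 4 ->
  [primitive G, on setT | 'P].
Proof.
move=> good trG n4; rewrite /primitive trG /=.
apply/existsPn=> Q; apply/negP=> /and3P[partQ actQ /andP[Q1 QT]].
have /card_gt0P[B QB] := ltnW Q1.
have cardQ := block_card partQ actQ trG QB; set d := #|B| in cardQ.
have cardT : #|T| = (#|Q| * d)%N by rewrite -cardsT (card_uniform_partition cardQ).
have d1 : 1 < d by move: QT; rewrite cardsT cardT; nia.
have dich q : good_prime #|T| q -> (exists i, d = q ^ i)%N \/ #|Q| < q.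
  move=> gq; apply: (block_power_or_few partQ actQ cardQ); rewrite ?(ltnW d1) ?good //.
  by case/andP: gq.
have [|p [k [l [pr_p k0 l0 bk dl]]]] := prime_power_factors Q1 d1.
  move=> p pr_p pb; have [|//|ltp] := dich p.
    by rewrite /good_prime pr_p cardT dvdn_mulr.
  by move: (dvdn_leq (ltnW Q1) pb); rewrite leqNgt ltp.
have p_d : p %| d by rewrite dl dvdn_exp.
have p_b : p %| #|Q| by rewrite bk dvdn_exp.
have count q r : good_prime #|T| q -> q != p -> r < q -> r < #|T| ->
    q %| #|T| - r -> #|Q| %| r.
  move=> gq qp ltrq ltrT dv; have [[i di]|ltQ] := dich q gq.
    case: i di => [|i] di; first by rewrite di in d1.
    have : q %| d by rewrite di expnS dvdn_mulr.
    have pr_q : prime q by case/andP: gq.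
    by rewrite dl Euclid_dvdX // dvdn_prime2 // (negPf qp).
  apply: (block_number_dvd partQ actQ cardQ) ltQ _ _ _ => //; last exact: good.
  by case/andP: gq.
(* For odd [p], a prime factor [q] of [n - 2] makes the number of blocks, which is at least 3,
   divide 2. *)
have [op | ep] := boolP (odd p).
  have p3 : 2 < p by case: p op pr_p {count bk dl p_d p_b} => [|[|[]]].
  have b3 : 2 < #|Q| by apply: leq_trans p3 _; apply: dvdn_leq (ltnW Q1) p_b.
  have d3 : 2 < d by apply: leq_trans p3 _; apply: dvdn_leq (ltnW d1) p_d.
  have T9 : 8 < #|T| by rewrite cardT; nia.
  have oT : odd #|T| by rewrite cardT oddM bk dl !oddX op !orbT.
  have oT2 : odd (#|T| - 2) by rewrite oddB ?oT //; lia.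
  have pr_q : prime (pdiv (#|T| - 2)) by apply: pdiv_prime; lia.
  have q_dv := pdiv_dvd (#|T| - 2).
  have oq := dvdn_odd q_dv oT2.
  set q := pdiv _ in pr_q q_dv oq.
  have q3 : 2 < q by case: q oq pr_q {q_dv} => [|[|[]]].
  have : #|Q| %| 2.
    apply: (count q) => //; try lia.
      by rewrite /good_prime pr_q oq q_dv /= (leq_trans _ T9) ?orbT.
    apply: contraTneq q_dv => ->; rewrite dvdn_subr ?(leq_trans _ T9) //.
      by rewrite dvdn_prime2 //; lia.
    by rewrite cardT dvdn_mulr.
  by move/dvdn_leq=> /(_ isT); lia.
have p2 : p = 2 by case: (even_prime pr_p) => // op; rewrite op in ep.
move: p_b p_d bk dl n4; rewrite {}p2 in count ep pr_p * => p_b p_d bk dl n4.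
(* For [p = 2], a prime factor [q] of [n - 3] makes the even number of blocks divide 3; here [q] is
   not 3 because [n] is a power of 2. *)
have T8 : 7 < #|T|.
  move: n4; rewrite cardT bk dl -expnD => n4.
  have : 2 < k + l by case: k l k0 l0 n4 {bk dl} => [|[|k]] // [|[|l]] // ; lia.
  by move/(leq_pexp2l (isT : 0 < 2)).
have eT : ~~ odd #|T| by rewrite -dvdn2 cardT dvdn_mulr.
have oT3 : odd (#|T| - 3) by rewrite oddB ?(negPf eT) //; lia.
have pr_q : prime (pdiv (#|T| - 3)) by apply: pdiv_prime; lia.
have q_dv := pdiv_dvd (#|T| - 3).
have oq := dvdn_odd q_dv oT3.
set q := pdiv _ in pr_q q_dv oq.
have T3 : 3 <= #|T| by lia.
have q3 : q != 3.
  have : ~~ (3 %| #|T|) by rewrite cardT bk dl -expnD Euclid_dvdX.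
  apply: contraNneq => q3.
  by rewrite -(subnK T3) dvdn_addl // -{1}q3.
have q4 : 3 < q by case: q oq pr_q q3 {q_dv} => [|[|[|[]]]].
have : #|Q| %| 3.
  apply: (count q) => //; try lia.
  by rewrite /good_prime pr_q oq q_dv T3 /= !orbT.
by move/(dvdn_trans p_b).
Qed.

(** * Jordan's theorem *)

Lemma perm_mem_imset (T : finType) (s : {perm T}) (A : {set T}) (x : T) :
  (s x \in s @: A) = (x \in A).
Proof. by rewrite mem_imset //; apply: perm_inj. Qed.

Lemma card_perm_imset (T : finType) (s : {perm T}) (A : {set T}) : #|s @: A| = #|A|.
Proof. by apply: card_imset; apply: perm_inj. Qed.

(** Otherwise [J] is a block and its stabiliser contains that of a point [x] of [J]. By maximality
    it is the stabiliser of [x], so that [J] is [[set x]], or all of [H], so that [J] is [S]. *)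
Lemma primitive_move_set (T : finType) (H : {group {perm T}}) (S J : {set T}) :
    [primitive H, on S | 'P] -> J \subset S -> 1 < #|J| < #|S| ->
  exists s, [/\ s \in H, s @: J != J & s @: J :&: J != set0].
Proof.
move=> primH sJS /andP[J1 JS].
have [/exists_inP[s Hs /andP[]] | /exists_inPn fixJ] :=
  boolP [exists s in H, (s @: J != J) && (s @: J :&: J != set0)]; first by exists s.
have {}fixJ s x : s \in H -> x \in J -> s x \in J -> s @: J = J.
  move=> Hs Jx Jsx; have := fixJ s Hs; rewrite negb_and negbK => /orP[/eqP //|].
  by rewrite negbK => /eqP/setP/(_ (s x)); rewrite !inE Jsx imset_f.
have [x [y [Jx Jy xy]]] := card_gt1P J1.
have [trH _] := andP primH; have Sx := subsetP sJS x Jx.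
have actP : [acts H, on S | 'P] := atrans_acts trH.
move: primH; rewrite (trans_prim_astab Sx trH) => /maximal_eqP[_ maxC].
case: (maxC 'N_H(J | 'P)%G) => /= [||eqN|eqN].
- apply/subsetP=> s /setIP[Hs /astab1P /= sx]; rewrite inE Hs.
  have sJ : s @: J = J by apply: (fixJ s x); rewrite // -[s x]/(aperm x s) sx.
  apply/astabsP=> z; rewrite -{1}sJ; exact: perm_mem_imset.
- exact: subsetIl.
- have [s Hs def_y] := atransP2 trH Sx (subsetP sJS y Jy).
  have sJ : s @: J = J by apply: (fixJ s x); rewrite // -[s x]/(aperm x s) -def_y.
  have : s \in 'N_H(J | 'P).
    rewrite inE Hs; apply/astabsP=> z; rewrite -{1}sJ; exact: perm_mem_imset.
  by rewrite eqN => /setIP[_ /astab1P]; rewrite -def_y => yx; rewrite yx eqxx in xy.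
have : S \subset J; last by move/subset_leq_card; rewrite leqNgt JS.
apply/subsetP=> z Sz; have [s Hs ->] := atransP2 trH Sx Sz.
by move: Hs; rewrite -eqN => /setIP[_ /astabsP->].
Qed.

Lemma mem_astab_setC (T : finType) (G : {group {perm T}}) (A : {set T}) (s : {perm T}) :
  (s \in 'C_G(~: A | 'P)) = (s \in G) && perm_on A s.
Proof.
rewrite inE; congr (_ && _); apply/astabP/subsetP=> [fix_s x | onA x].
  by rewrite inE; apply: contraR => nAx; apply/eqP/(fix_s x); rewrite inE.
by rewrite inE => nAx; apply: contraNeq nAx => sx; apply: onA.
Qed.

Lemma transitive_superset (aT : finGroupType) (rT : finType)
    (to : {action aT &-> rT}) (G H : {group aT}) (S : {set rT}) :
    G \subset H -> [acts H, on S | to] -> [transitive G, on S | to] ->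
  [transitive H, on S | to].
Proof.
move=> sGH actH /imsetP[x Sx defS]; apply/imsetP; exists x => //.
by apply/eqP; rewrite eqEsubset {1}defS imsetS // acts_sub_orbit.
Qed.

Lemma ntransitive_superset (aT : finGroupType) (rT : finType)
    (to : {action aT &-> rT}) (m : nat) (G H : {group aT}) (S : {set rT}) :
    G \subset H -> [acts H, on S | to] -> [transitive^m G, on S | to] ->
  [transitive^m H, on S | to].
Proof.
move=> sGH actH; apply: transitive_superset => //.
apply/actsP=> a Ha t; apply/idP/idP=> dt; last exact: n_act_dtuple (subsetP actH a Ha) dt.
rewrite -[t](actK (to * m)%act a); apply: n_act_dtuple dt.
by rewrite groupV (subsetP actH).
Qed.

Lemma astab_setC_acts (T : finType) (G : {group {perm T}}) (A : {set T}) :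
  [acts 'C_G(~: A | 'P), on A | 'P].
Proof.
by apply/actsP=> s; rewrite mem_astab_setC => /andP[_ onA] x; apply: perm_closed.
Qed.

(* Among the translates [A'] of [A] that meet [A] without being equal to it, one
   with [J = A' :\: A] minimal has [#|J| = 1]: otherwise primitivity on [A'] yields
   [s] with [s @: J] meeting but not equal to [J], and [s @: A] is a translate with
   a smaller difference [J :\: s @: J]. *)
Lemma jordan_step (T : finType) (G : {group {perm T}}) (A : {set T}) :
    [primitive G, on setT | 'P] -> [primitive 'C_G(~: A | 'P), on A | 'P] ->
    1 < #|A| < #|T| ->
  exists2 b, b \notin A
    & [transitive 'C_G(~: (b |: A) | 'P), on b |: A | 'P].
Proof.
move=> primG primA ltA.
pose P g := [&& g \in G, g @: A != A & g @: A :&: A != set0].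
have [|g0 [Gg0 ne0 meet0]] := primitive_move_set primG (subsetT A); first by rewrite cardsT.
have Pg0 : P g0 by apply/and3P.
case: (arg_minnP (fun g : {perm T} => #|g @: A :\: A|) Pg0) => g /and3P[Gg neA meetA] min_g.
set A' := g @: A in neA meetA min_g; set J := A' :\: A.
have cardA' : #|A'| = #|A| by apply: card_imset; apply: perm_inj.
have J0 : J != set0.
  by rewrite setD_eq0; apply: contraNN neA => sub; rewrite eqEcard sub cardA' leqnn.
have sJA' : J \subset A' by apply: subsetDl.
have ltJ : #|J| < #|A'|.
  apply: proper_card; rewrite properEneq sJA' andbT.
  by apply: contraNneq meetA; rewrite /J => <-; rewrite setIC setIDA setDIl setDv set0I.
have conjP s : s \in 'C_G(~: A | 'P) -> (s ^ g \in G) && perm_on A' (s ^ g).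
  rewrite mem_astab_setC => /andP[Gs onA]; rewrite groupJ //=.
  apply/subsetP=> x; rewrite inE -[x](permKV g) permJ (inj_eq perm_inj) => sx.
  by apply: imset_f; apply: (subsetP onA).
have J1 : #|J| <= 1.
  rewrite leqNgt; apply/negP=> J1.
  (* Primitivity on [A] applies to the preimage of [J] under [g]; conjugation by [g] carries the
     element found over to [A']. *)
  pose J' := g^-1 @: J.
  have gJ' : g @: J' = J.
    by rewrite -imset_comp -[RHS]imset_id; apply: eq_imset => x /=; rewrite permKV.
  have sJ'A : J' \subset A.
    apply/subsetP=> _ /imsetP[x Jx ->]; have /imsetP[y Ay ->] := subsetP sJA' x Jx.
    by rewrite permK.
  have cJ' : #|J'| = #|J| by apply: card_imset; apply: perm_inj.
  have [|s0 [Cs0 neJ meetJ]] := primitive_move_set primA sJ'A.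
    by rewrite cJ' J1 -cardA'.
  have /andP[Gs onA'] := conjP s0 Cs0; set s := s0 ^ g in Gs onA'.
  have sJ : s @: J = g @: (s0 @: J').
    rewrite -gJ' -!imset_comp; apply: eq_imset => x /=; by rewrite permJ.
  have {}neJ : s @: J != J.
    by rewrite sJ -[X in _ != X]gJ'; apply: contraNneq neJ => /(imset_inj (@perm_inj _ g)) ->.
  have {}meetJ : s @: J :&: J != set0.
    rewrite sJ -gJ' -imsetI; last by move=> ? ? _ _; apply: perm_inj.
    by rewrite imset_eq0.
  have sub : s @: A :\: A \subset J :\: s @: J.
    apply/subsetP=> _ /setDP[/imsetP[x Ax ->] nAsx].
    have A'x : x \in A'.
      by apply: contraR nAsx => nA'x; rewrite (out_perm onA').
    rewrite !inE (perm_closed _ onA') A'x nAsx /= !andbT.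
    by rewrite mem_imset ?inE ?Ax //; apply: perm_inj.
  have Ps : P s.
    rewrite /P Gs /=; apply/andP; split.
      have : ~~ (J \subset s @: J).
        by apply: contraNN neJ => sub'; rewrite eq_sym eqEcard sub' card_perm_imset leqnn.
      case/subsetPn=> y Jy; apply: contraNneq => sA.
      rewrite -[y](permKV s) mem_imset; last exact: perm_inj.
      move: (Jy); rewrite !inE => /andP[nAy A'y].
      rewrite -(perm_closed _ onA') permKV A'y andbT.
      apply: contraNN nAy => As; rewrite -sA -[y](permKV s); exact: imset_f.
    have : ~~ (A \subset A').
      by apply: contraNN neA => sub'; rewrite eq_sym eqEcard sub' cardA' leqnn.
    case/subsetPn=> z Az nA'z; apply/set0Pn; exists z; rewrite inE Az andbT.
    by rewrite -(out_perm onA' nA'z) imset_f.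
  have := leq_trans (min_g s Ps) (subset_leq_card sub).
  rewrite leqNgt proper_card // properEneq subsetDl andbT.
  apply: contraNneq meetJ => /setDidPl; rewrite disjoint_sym => dis.
  by rewrite setI_eq0.
have /cards1P[b defJ] : #|J| == 1%N by rewrite eqn_leq J1 card_gt0.
have /setDP[A'b nAb] : b \in J by rewrite defJ set11.
exists b => //.
have /set0Pn[a /setIP[A'a Aa]] := meetA.
apply/imsetP; exists a; first by rewrite !inE Aa orbT.
apply/eqP; rewrite eq_sym eqEsubset acts_sub_orbit; last exact: astab_setC_acts.
(* Both [a] and [b] lie in [A'], which is contained in [b |: A], so an element of [G] supported on
   [A'] sends [a] to [b]; the points of [A] are reached within [A]. *)
rewrite setU1r //=; apply/subsetP=> y /setU1P[->|Ay].
  have /imsetP[a' Aa' def_a] := A'a; have /imsetP[b' Ab' def_b] := A'b.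
  have [s0 Cs0 def_b'] := atransP2 (proj1 (andP primA)) Aa' Ab'.
  have /andP[Gs onA'] := conjP s0 Cs0; apply/imsetP; exists (s0 ^ g).
    rewrite mem_astab_setC Gs /=; apply: subset_trans onA' _.
    apply/subsetP=> x A'x; rewrite !inE; have [//|nAx] := boolP (x \in A).
      by rewrite orbT.
    by have : x \in J by [rewrite inE nAx]; rewrite defJ inE => ->.
  by rewrite /= apermE def_a permJ def_b def_b'.
have [s Cs ->] := atransP2 (proj1 (andP primA)) Aa Ay.
apply: mem_orbit; move: Cs; rewrite !mem_astab_setC => /andP[-> onA] /=.
by apply: subset_trans onA _; apply: subsetU1.
Qed.

(** Each step adds a point [b] to [A]. The stabiliser of [b] contains the group supported on [A], so
    the transitivity rises by one, and 2-transitivity gives primitivity on [b |: A]. *)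
Lemma jordan_transitive (T : finType) (G : {group {perm T}}) (k j : nat) (A : {set T}) :
    [primitive G, on setT | 'P] -> [primitive 'C_G(~: A | 'P), on A | 'P] ->
    1 < #|A| -> #|T| = #|A| + k -> 0 < j ->
    [transitive^j 'C_G(~: A | 'P), on A | 'P] ->
  [transitive^(j + k) G, on setT | 'P].
Proof.
move=> primG; elim: k j A => [|k IHk] j A primA A1 cardT j0 trA.
  have AT : A = setT by apply/eqP; rewrite eqEcard subsetT cardsT cardT addn0 leqnn.
  rewrite addn0; apply: (ntransitive_superset (subsetIl G 'C(~: A | 'P))).
    by apply: atrans_acts; case/andP: primG.
  by rewrite -[X in ntransitive _ _ X]AT.
have [|b nAb trAb] := jordan_step primG primA; first by rewrite A1 cardT; lia.
have trAb' : [transitive^j.+1 'C_G(~: (b |: A) | 'P), on b |: A | 'P].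
  apply: (stab_ntransitiveI (x := b)) => //; first exact: setU11.
  rewrite setU1K //.
  apply: (ntransitive_superset (G := 'C_G(~: A | 'P)%G)) trA => /=.
    apply/subsetP=> s; rewrite mem_astab_setC => /andP[Gs onA].
    rewrite in_setI mem_astab_setC Gs /perm_on (subset_trans onA (subsetU1 _ _)) /=.
    by apply/astab1P; rewrite /= apermE (out_perm onA).
  apply/actsP=> s /setIP[]; rewrite mem_astab_setC => /andP[_ onAb].
  move=> /astab1P; rewrite /= apermE => sb x; rewrite /= apermE.
  have := perm_closed x onAb; have [->|xb] := eqVneq x b; first by rewrite sb.
  have sxb : s x != b by rewrite -[b in _ != b]sb (inj_eq perm_inj).
  by rewrite !in_setU1 (negPf xb) (negPf sxb).
rewrite addnS -addSn; apply: (IHk _ (b |: A)) => //.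
- exact: ntransitive_primitive trAb'.
- by rewrite cardsU1 nAb; lia.
- by rewrite cardT cardsU1 nAb; lia.
Qed.

Lemma prime_transitive_primitive (T : finType) (H : {group {perm T}}) (S : {set T}) :
    prime #|S| -> [transitive H, on S | 'P] -> [primitive H, on S | 'P].
Proof.
move=> prS trH; have [x Sx _] := imsetP trH.
rewrite (trans_prim_astab Sx trH) /maximal_eq; apply/orP; right.
apply: p_index_maximal; first exact: subsetIl.
by rewrite -card_orbit (atransP trH).
Qed.

Lemma jordan_cycle (T : finType) (G : {group {perm T}}) (A : {set T}) (s : {perm T}) :
    [primitive G, on setT | 'P] -> prime #|A| -> s \in G -> is_cycle_on A s ->
  [transitive^(1 + (#|T| - #|A|)) G, on setT | 'P].
Proof.
move=> primG prA Gs [onA cyc].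
have tr1 : [transitive 'C_G(~: A | 'P), on A | 'P].
  have /card_gt0P[x Ax] := prime_gt0 prA.
  apply: (transitive_superset (G := <[s]>%G)).
  - by rewrite cycle_subG mem_astab_setC Gs.
  - exact: astab_setC_acts.
  by apply/imsetP; exists x; rewrite // -{1}(cyc x Ax) porbitE.
apply: (jordan_transitive (A := A)) => //.
- exact: prime_transitive_primitive.
- exact: prime_gt1.
- by rewrite subnKC // max_card.
have [x Ax _] := imsetP tr1.
apply: (stab_ntransitiveI Ax tr1); exact: ntransitive0.
Qed.

(** * Groups containing the alternating group *)

(** The products in the hypothesis are the 3-cycles. An even permutation is a product of pairs
    [tperm a b * tperm c d], and inserting [tperm a c] twice reduces each pair to 3-cycles. *)
Lemma Alt_sub_of_3cycles (T : finType) (G : {group {perm T}}) :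
    (forall x y z, uniq [:: x; y; z] -> tperm x y * tperm x z \in G) ->
  'Alt_T \subset G.
Proof.
move=> G3.
have share (a b c : T) : a != b -> a != c -> tperm a b * tperm a c \in G.
  move=> ab ac; have [->|bc] := eqVneq b c; first by rewrite tperm2 group1.
  by apply: G3; rewrite /= !inE negb_or ab ac bc.
have G2 (a b c d : T) : a != b -> c != d -> tperm a b * tperm c d \in G.
  move=> ab cd; have [eac|ac] := eqVneq a c; first by rewrite -eac share // eac.
  have -> : tperm a b * tperm c d = (tperm a b * tperm a c) * (tperm c a * tperm c d).
    by rewrite (tpermC c a) mulgA -(mulgA (tperm a b)) tperm2 mulg1.
  by rewrite groupM // share // eq_sym.
apply/subsetP=> s; rewrite Alt_even; have [ts -> dts] := prod_tpermP s.
rewrite odd_perm_prod //; move: dts.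
have [n] := ubnP (size ts); elim: n ts => // n IHn [|t [|u ts]] //= le_n.
  by rewrite big_nil group1.
case/and3P=> dt du dts; rewrite negbK => even_ts.
by rewrite !big_cons mulgA groupM ?G2 ?IHn //; lia.
Qed.

Lemma mem_dtuple_setT (T : finType) (n : nat) (t : n.-tuple T) :
  (t \in n.-dtuple([set: T])) = uniq t.
Proof. by rewrite inE andb_idr // => _; apply/subsetP=> z; rewrite inE. Qed.

Lemma Alt_sub_of_transitive3 (T : finType) (G : {group {perm T}}) (x y z : T) :
    [transitive^3 G, on setT | 'P] -> uniq [:: x; y; z] ->
    tperm x y * tperm x z \in G ->
  'Alt_T \subset G.
Proof.
move=> tr3 uxyz Gxyz; apply: Alt_sub_of_3cycles => a b c uabc.
have [| |g Gg /(congr1 val) [-> -> ->]] :=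
  atransP2 tr3 (x := [tuple x; y; z]) (y := [tuple a; b; c]).
- by rewrite mem_dtuple_setT.
- by rewrite mem_dtuple_setT.
by rewrite !apermE -!tpermJ -conjMg groupJ.
Qed.

(* Conjugating [s] by an [h] in [G] such that [h @: A] meets [A] in [a] only gives [t],
   and the commutator of [t] and [s] is a 3-cycle. *)
Lemma commutator_3cycle (T : finType) (G : {group {perm T}}) (A : {set T})
    (s : {perm T}) (a : T) (q : nat) :
    #|A| = q -> [transitive^q G, on setT | 'P] -> s \in G -> perm_on A s -> s a != a ->
    q.*2 <= #|T|.+1 ->
  exists x y z, uniq [:: x; y; z] /\ tperm x y * tperm x z \in G.
Proof.
move=> <- trG Gs onA sa leT.
have Aa : a \in A by apply: contraR sa => nAa; rewrite (out_perm onA).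
have cardA : #|A| = #|A :\ a|.+1 by rewrite (cardsD1 a) Aa.
pose l := enum (A :\ a); pose l' := take #|A :\ a| (enum (~: A)).
have sz : size (a :: l) == #|A| by rewrite /= -cardE -cardA.
(* As [2q <= n + 1], at least [q - 1] points lie outside [A], enough for [h] to fix [a] and send the
   rest of [A] there. *)
have sz' : size (a :: l') == #|A|.
  rewrite /= size_take -cardE cardA; have := cardsC A; case: ltnP; lia.
have [| |h Gh /(congr1 val) [ha hl]] := atransP2 trG (x := Tuple sz) (y := Tuple sz').
- rewrite mem_dtuple_setT /= enum_uniq andbT mem_enum !inE eqxx //.
- rewrite mem_dtuple_setT /= take_uniq ?enum_uniq // andbT.
  by apply/negP=> /mem_take; rewrite mem_enum !inE Aa.
rewrite apermE in ha.
have hA z : z \in A -> z != a -> h z \notin A.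
  move=> Az za; have : h z \in l'.
    by rewrite hl; apply: map_f; rewrite mem_enum !inE za.
  by move/mem_take; rewrite mem_enum inE.
set t := s ^ h; have Gt : t \in G by rewrite groupJ.
have onhA : perm_on (h @: A) t.
  apply/subsetP=> z; rewrite inE -[z](permKV h) permJ (inj_eq perm_inj) perm_mem_imset.
  exact: (subsetP onA).
set x := s a; have Ax : x \in A by rewrite perm_closed.
have hAx : x \notin h @: A.
  apply/imsetP=> -[z Az xz]; have [za|za] := eqVneq z a.
    by case/eqP: sa; rewrite -/x xz za -ha.
  by move: (hA z Az za); rewrite -xz Ax.
set y := t a; have ha' : a = h a by [].
have hAy : y \in h @: A by rewrite perm_closed // {1}ha' perm_mem_imset.
have ya : y != a.
  by rewrite /y {1}ha' permJ {2}ha' (inj_eq perm_inj).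
have tx : t x = x by rewrite (out_perm onhA).
pose c := tperm a x.
(* [s * c] fixes [h @: A] pointwise and so commutes with [t]; the commutator of [t] and [s] is then
   the product of the transpositions [c ^ t] and [c]. *)
have ts : t ^ s = t ^ c.
  have comm : commute t (s * c).
    apply: (@perm_onC _ (h @: A) (~: (h @: A))) => //; last first.
      by rewrite -setI_eq0 setICr.
    apply/subsetP=> z; rewrite !inE permM; apply: contraNN => /imsetP[w Aw ->].
    have [->|wa] := eqVneq w a; first by rewrite -ha -/x /c tpermR.
    have := hA w Aw wa => nA; rewrite (out_perm onA nA) tpermD //.
      by apply: contraNneq nA => <-.
    by apply: contraNneq nA => <-.
  have eqt : t ^ (s * c) = t by rewrite conjgE comm mulKg.
  by rewrite -[in RHS]eqt -(conjgM t (s * c) c) -mulgA tperm2 mulg1.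
exists x, y, a; split.
  rewrite /= !inE negb_or sa ya !andbT /=.
  by apply: contraNneq hAx => ->.
have -> : tperm x y * tperm x a = t^-1 * t ^ s.
  rewrite ts /conjg /c tpermV; transitivity (tperm a x ^ t * tperm a x).
    by rewrite tpermJ tx (tpermC x y) (tpermC x a).
  by rewrite /conjg !mulgA.
by rewrite groupM ?groupV ?groupJ.
Qed.

Lemma primitive_Alt_sub (T : finType) (G : {group {perm T}}) (q : nat) :
    [primitive G, on setT | 'P] -> prime q ->
    ~~ (q %| #|[set: {perm T}] : G|) -> 3 < #|T| -> q.*2 <= #|T|.+1 ->
  'Alt_T \subset G.
Proof.
move=> primG pr_q q'G T4 leT; have q1 := prime_gt1 pr_q.
have [|A [s [cardA Gs cyc]]] := prime_power_cycle_mem (k := 1) pr_q q'G.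
  by rewrite expn1; lia.
rewrite expn1 in cardA.
have trG := jordan_cycle primG (etrans (congr1 prime cardA) pr_q) Gs cyc.
rewrite cardA in trG.
have [a Aa] : exists a, a \in A by apply/card_gt0P; rewrite cardA ltnW.
have sa : s a != a.
  have [_ /(_ a Aa) por] := cyc.
  have := porbit_expg_fix s a 1; rewrite por expg1 cardA dvdn1 => ->.
  by rewrite neq_ltn q1 orbT.
(* The degree of transitivity [1 + (n - q)] is at least [q] by the bound on [q], and at least 3
   since also [n > 3]. *)
have trq : [transitive^q G, on setT | 'P] by apply: ntransitive_weak trG; lia.
have tr3 : [transitive^3 G, on setT | 'P] by apply: ntransitive_weak trG; lia.
have [x [y [z [uxyz Gxyz]]]] := commutator_3cycle cardA trq Gs (proj1 cyc) sa leT.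
exact: Alt_sub_of_transitive3 tr3 uxyz Gxyz.
Qed.

(* A [p]-element acts trivially on fewer than [p] cosets, so [G] contains all
   [#|T|]-cycles; the quotient of two of them is a 3-cycle. *)
Lemma prime_degree_Alt_sub (T : finType) (G : {group {perm T}}) :
    prime #|T| -> 2 < #|T| -> #|[set: {perm T}] : G| < #|T| ->
    [transitive^3 G, on setT | 'P] ->
  'Alt_T \subset G.
Proof.
move=> prT T3 ltT tr3.
have [c cyc] := cycle_perm_exists [set: T].
have pc : #|T|.-elt c.
  apply: (@pnat_dvd _ #|T|); last by rewrite pnat_id.
  by rewrite order_dvdn -cardsT (is_cycle_on_order cyc).
have cG g : c ^ g \in G.
  by apply: p_elt_small_index (subsetT G) ltT (in_setT _) _; rewrite p_eltJ.
have fixc x k : ((c ^+ k) x == x) = (#|T| %| k).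
  by rewrite porbit_expg_fix (proj2 cyc) ?inE // cardsT.
have /card_gt0P[u _] : 0 < #|T| by apply: ltnW; apply: ltnW.
pose v := c u; pose w := c v.
have uv : v != u by have := fixc u 1%N; rewrite expg1 dvdn1 => ->; lia.
have vw : w != v by have := fixc v 1%N; rewrite expg1 dvdn1 => ->; lia.
have uw : w != u.
  have := fixc u 2; rewrite permX /= => ->.
  by apply/negP=> /dvdn_leq => /(_ isT); rewrite leqNgt T3.
apply: (Alt_sub_of_transitive3 (x := v) (y := w) (z := u) tr3).
  by rewrite /= !inE negb_or eq_sym vw uv uw.
have -> : tperm v w * tperm v u = c^-1 * c ^ tperm u v.
  rewrite /conjg tpermV; transitivity (tperm u v ^ c * tperm u v).
    by rewrite tpermJ (tpermC v u).
  by rewrite /conjg !mulgA.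
by rewrite groupM ?groupV // -[c]conjg1.
Qed.

Lemma index_lt3_Alt_sub (T : finType) (G : {group {perm T}}) :
  #|[set: {perm T}] : G| < 3 -> 'Alt_T \subset G.
Proof.
move=> lt3; apply: Alt_sub_of_3cycles => x y z /=; rewrite !inE negb_or !andbT.
case/andP=> /andP[xy xz] yz.
apply: p_elt_small_index (subsetT G) lt3 (in_setT _) _.
apply: (@pnat_dvd _ 3) => //; rewrite order_dvdn; apply/eqP.
rewrite expgS expgS expg1 !mulgA.
have conj2 a b c : a != b -> b != c -> a != c ->
    tperm a b * tperm a c * tperm a b = tperm b c.
  move=> ab bc ac; rewrite -[RHS](_ : tperm a c ^ tperm a b = _).
    by rewrite conjgE tpermV mulgA.
  by rewrite tpermJ tpermL tpermD // eq_sym.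
rewrite conj2 // -mulgA -mulgA (mulgA (tperm x z)) conj2 //; last by rewrite eq_sym.
by rewrite (tpermC z) tperm2.
Qed.

Lemma card_dtuple_setT (T : finType) (n : nat) : #|n.-dtuple([set: T])| = #|T| ^_ n.
Proof.
rewrite -card_uniq_tuples; apply: eq_card => t; rewrite mem_dtuple_setT inE.
by rewrite andb_idl // => _; apply/allP.
Qed.

(** A 5-cycle is too long for the commutator argument, but it makes [G] 3-transitive, so 210 divides
    [|G|] and the index divides 24. Not being a multiple of 4, the index is at most 6. *)
Lemma degree7_Alt_sub (G : {group 'S_7}) :
    [primitive G, on setT | 'P] -> ~~ (5 %| #|[set: 'S_7] : G|) ->
    ~~ (4 %| #|[set: 'S_7] : G|) ->
  'Alt_('I_7) \subset G.
Proof.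
move=> primG n5 n4; set m := #|_ : _| in n5 n4.
have [|A [s [cardA Gs cyc]]] := prime_power_cycle_mem (k := 1) (isT : prime 5) n5.
  by rewrite card_ord.
have tr3 := jordan_cycle primG (etrans (congr1 prime cardA) isT) Gs cyc.
rewrite cardA card_ord in tr3.
have m24 : m \in divisors 24.
  rewrite -dvdn_divisors // -(@dvdn_pmul2l 210) //.
  have -> : (210 * 24)%N = (#|G| * m)%N.
    by rewrite (Lagrange (subsetT G)) cardsT card_Sn.
  rewrite dvdn_mul //; have := atrans_dvd tr3.
  by rewrite card_dtuple_setT card_ord.
apply: prime_degree_Alt_sub tr3; rewrite ?card_ord // -/m.
by move: m24 n4; rewrite -[divisors 24]/[:: 1; 2; 3; 4; 6; 8; 12; 24]%N !inE;
  do ?[case/predU1P=> [-> //|]]; move/eqP->.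
Qed.

Lemma good_index_Alt_sub (n : nat) (G : {group 'S_n}) : n != 4 ->
    (forall q, good_prime n q -> ~~ (q %| #|[set: 'S_n] : G|)) ->
    (n = 7 -> ~~ (4 %| #|[set: 'S_n] : G|)) ->
  'Alt_('I_n) \subset G.
Proof.
move=> n4 good ndvd4; set m := #|_ : _| in good ndvd4.
have m_dv : m %| n`! by rewrite -card_Sn -cardsT dvdn_indexg.
have [n3 | n3] := leqP n 3.
  apply: index_lt3_Alt_sub; rewrite -/m.
  have m_le := dvdn_leq (fact_gt0 n) m_dv.
  have [n_eq3 | n_neq3] := eqVneq n 3; last first.
    apply: leq_ltn_trans m_le _.
    by case: (n) n3 n_neq3 => [|[|[|[|]]]].
  have : ~~ (3 %| m) by apply: good; rewrite n_eq3.
  rewrite n_eq3 in m_dv; have : m \in divisors 6 by rewrite -dvdn_divisors.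
  by rewrite -[divisors 6]/[:: 1; 2; 3; 6]%N !inE;
    do ?[case/predU1P=> [-> //|]]; move/eqP->.
have coG : coprime n m.
  rewrite coprime_has_primes ?indexg_gt0 // ?(ltn_trans _ n3) //.
  apply/hasPn=> q; rewrite !mem_primes => /and3P[pr_q _ q_m].
  by apply/and3P=> -[_ _ q_n]; have := good q; rewrite /good_prime pr_q q_n q_m => /(_ isT).
have trG : [transitive G, on [set: 'I_n] | 'P].
  apply: (coprime_index_transitive (subsetT G)); first by rewrite cardsT card_ord.
  by have := Sym_trans 'I_n; apply: ntransitive1; rewrite card_ord (ltn_trans _ n3).
have primG : [primitive G, on [set: 'I_n] | 'P].
  by apply: good_index_primitive; rewrite ?card_ord.
have [n7 | n7] := eqVneq n 7.
  move: G @m good ndvd4 primG {trG coG m_dv}; rewrite n7 => G m good ndvd4 primG.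
  by apply: degree7_Alt_sub; rewrite ?ndvd4 ?good.
have [q good_q le_q] := exists_good_prime n3 n7.
apply: (@primitive_Alt_sub _ _ q) => //; rewrite ?card_ord ?good //.
by case/andP: good_q.
Qed.

(** * Cosets with the proportion of the symmetric group *)

Lemma fpf_conj (n : nat) (s g : 'S_n) :
  fixed_point_free (s ^ g) = fixed_point_free s.
Proof.
apply/forallP/forallP=> fs i; last by rewrite -[i](permKV g) permJ (inj_eq perm_inj).
by have := fs (g i); rewrite permJ (inj_eq perm_inj).
Qed.

Lemma fpf_proportion_eq (n : nat) (G : {group 'S_n}) (C : {set 'S_n}) :
    #|C| = #|G| -> fpf_proportion C = fpf_proportion [set: 'S_n] ->
  (#|[set s in C | fixed_point_free s]| * #|[set: 'S_n] : G|)%N =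
  #|[set s : 'S_n | fixed_point_free s]|.
Proof.
rewrite /fpf_proportion => -> eqp.
have G0 := cardG_gt0 G; have S0 : 0 < #|[set: 'S_n]| by apply: (cardG_gt0 [set: 'S_n]%G).
have eqF : [set s in [set: 'S_n] | fixed_point_free s] = [set s : 'S_n | fixed_point_free s].
  by apply/setP=> s; rewrite !inE.
move: eqp; rewrite eqF => /eqP.
rewrite eqr_div ?pnatr_eq0 -?lt0n // -!natrM eqr_nat -(Lagrange (subsetT G)).
move=> /eqP eqp; apply/eqP; rewrite -(eqn_pmul2r G0) -eqp -mulnA; apply/eqP.
by congr muln; rewrite mulnC.
Qed.

(* [G] is transitive, so its elements have 8 fixed points in total (Burnside), and
   each element of the 2-group [G] has an even number of them. *)
Lemma card_fpf_index3 (G : {group 'S_4}) : #|[set: 'S_4] : G| = 3 ->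
  #|[set s in G | fixed_point_free s]| = 5.
Proof.
move=> iG; have cardG : #|G| = 8.
  have := Lagrange (subsetT G); rewrite iG cardsT card_Sn => /eqP.
  by rewrite -[4`!]/(8 * 3)%N eqn_pmul2r // => /eqP.
have trS : [transitive [set: 'S_4], on setT | 'P].
  by have := Sym_trans 'I_4; rewrite card_ord => /ntransitive1; apply.
have trG : [transitive G, on setT | 'P].
  by apply: (coprime_index_transitive (subsetT G)) trS; rewrite iG cardsT card_ord.
have := Frobenius_Cauchy (atrans_acts trG).
have -> : #|orbit 'P G @: [set: 'I_4]| = 1%N.
  apply/eqP/cards1P; exists [set: 'I_4]; apply/setP=> X; rewrite inE.
  apply/imsetP/eqP=> [[i _ ->] | ->]; first exact: (atransP trG).
  by exists ord0; rewrite ?(atransP trG).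
rewrite mul1n cardG.
(* A non-identity element with a fixed point has exactly 2 of them, and the identity has 4 = 2 + 2.
   With [f] derangements in [G], Burnside's count reads [2 (8 - f) + 2 = 8]. *)
have fixE s : s \in G -> #|'Fix_([set: 'I_4] | 'P)[s]| =
    ((~~ fixed_point_free s) * 2 + (s == 1%g) * 2)%N.
  move=> Gs; case: eqP => [-> | s1].
    have -> : fixed_point_free (1 : 'S_4) = false.
      by apply/forallP=> /(_ ord0); rewrite perm1 eqxx.
    rewrite -[RHS]card_ord -cardsT; congr #|pred_of_set _|.
    by apply/setIidPl/subsetP=> i _; apply/afix1P; rewrite /= apermE perm1.
  have fixP i : (i \in 'Fix_([set: 'I_4] | 'P)[s]) = (s i == i).
    by rewrite in_setI in_setT; apply/afix1P/eqP.
  have even_fix : ~~ odd #|'Fix_([set: 'I_4] | 'P)[s]|.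
    have ps : 2.-group <[s]>.
      rewrite -/(2.-elt s); apply: (@pnat_dvd _ #|G|); first exact: order_dvdG.
      by rewrite cardG.
    have acts : [acts <[s]>, on [set: 'I_4] | 'P].
      by apply/actsP=> a _ i; rewrite !inE.
    have := pgroup_fix_mod ps acts; rewrite cardsT card_ord !modn2 afix_cycle //.
    by move/esym; case: (odd _).
  case: (boolP (fixed_point_free s)) => [/forallP fs | /forallPn[i]] /=.
    by apply/eqP; rewrite cards_eq0; apply/eqP/setP=> i; rewrite fixP inE (negPf (fs i)).
  rewrite negbK => si.
  have : 0 < #|'Fix_([set: 'I_4] | 'P)[s]| < 4.
    apply/andP; split; first by apply/card_gt0P; exists i; rewrite fixP.
    rewrite -[X in _ < X]card_ord -cardsT; apply: proper_card.
    rewrite properEneq subsetIl andbT; apply/eqP=> fixT; apply: s1.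
    by apply/permP=> k; rewrite perm1; apply/eqP; rewrite -fixP fixT.
  by case: #|_| even_fix => [|[|[|[|]]]].
rewrite (eq_bigr _ fixE) big_split /= -!big_distrl /=.
have -> : (\sum_(s in G) (s == 1%g))%N = 1%N.
  by rewrite (bigD1 1) ?group1 //= eqxx big1 // => s /andP[_ /negPf ->].
have := cardsID [set s : 'S_4 | fixed_point_free s] G.
have -> : G :&: [set s : 'S_4 | fixed_point_free s] = [set s in G | fixed_point_free s].
  by apply/setP=> s; rewrite !inE.
have -> : (\sum_(s in G) ~~ fixed_point_free s)%N =
    #|G :\: [set s : 'S_4 | fixed_point_free s]|.
  rewrite -sum1_card big_mkcond [RHS]big_mkcond; apply: eq_bigr => s _.
  by rewrite !inE; case: (s \in G); case: fixed_point_free.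
by rewrite cardG; move: #|[set s in G | _]| #|_ :\: _| => a b; clear; lia.
Qed.

(* [G] is not normal, so some [g] in [G] swaps the two other cosets [G :* x] and
   [G :* x :* g] by conjugation; they have equally many derangements, and the total
   would be 5 + 3 + 3. *)
Lemma fpf_rcoset_index3 (G : {group 'S_4}) (x : 'S_4) :
    #|[set: 'S_4] : G| = 3 -> #|[set s : 'S_4 | fixed_point_free s]| = 9 ->
  #|[set s in G :* x | fixed_point_free s]| <> 3.
Proof.
move=> iG D9 fx; have f1 := card_fpf_index3 iG.
have nGx : x \notin G by apply/negP=> /rcoset_id eqC; rewrite eqC f1 in fx.
(* If all of [G] preserved [G :* x], then [x] would normalise [G], which is maximal by its prime
   index and hence would be normal. Its index being odd, [G] would contain all 2-elements, among
   them the transpositions. *)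
have [nGall | /subsetPn[g Gg nCg]] := boolP (G \subset [set g | G :* x :* g == G :* x]).
  have Nx : x \in 'N(G).
    rewrite -groupV inE; apply/subsetP=> _ /imsetP[g Gg ->].
    have := subsetP nGall g Gg; rewrite inE => /eqP eqC.
    have : x * g \in G :* x by rewrite -eqC mem_rcoset mulgK rcoset_refl.
    by rewrite mem_rcoset conjgE invgK mulgA.
  have maxG : maximal G [set: 'S_4] by apply: p_index_maximal; rewrite ?subsetT ?iG.
  have /maximal_eqP[_ maxN] : maximal_eq G [set: 'S_4] by rewrite /maximal_eq maxG orbT.
  have nG : 'N(G) = [set: 'S_4].
    have [NG|//] := maxN 'N(G)%G (normG G) (subsetT _).
    by case/negP: nGx; have : x \in (G : {set _}); [rewrite -NG | ].
  have tG (s : 'S_4) : 2.-elt s -> s \in G.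
    move=> s2; have [|y _] := p_elt_conj_mem (subsetT G) (isT : prime 2) _ (in_setT s) s2.
      by rewrite iG.
    by rewrite memJ_norm // nG in_setT.
  have GT : [set: 'S_4] \subset G.
    apply/subsetP=> s _; have [ts -> _] := prod_tpermP s.
    apply: (big_ind (fun s => s \in G)) => [|? ?|t _]; [exact: group1 | exact: groupM |].
    apply: tG; apply: (@pnat_dvd _ 2) => //; rewrite order_dvdn expgS expg1.
    by rewrite tperm2.
  by have := iG; rewrite (eqP (_ : #|[set: 'S_4] : G| == 1%N)) // indexg_eq1.
move: nCg; rewrite inE => nCg.
have GxgE s : (s \in G :* x :* g) = (s ^ g^-1 \in G :* x).
  by rewrite !mem_rcoset conjgE invgK -!mulgA [RHS]groupMl.
pose F := [set s : 'S_4 | fixed_point_free s].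
have cardF3 : #|G :* x :* g :&: F| = 3.
  have -> : G :* x :* g :&: F = [set s in G :* x | fixed_point_free s] :^ g.
    by apply/setP=> s; rewrite mem_conjg !inE GxgE fpf_conj.
  by rewrite cardJg.
have cardF2 : #|G :* x :&: F| = 3.
  by rewrite -[RHS]fx; congr #|pred_of_set _|; apply/setP=> s; rewrite !inE.
have cardF1 : #|G :&: F| = 5.
  by rewrite -[RHS]f1; congr #|pred_of_set _|; apply/setP=> s; rewrite !inE.
have disj (y z : 'S_4) : G :* y != G :* z -> (G :* y :&: F) :&: (G :* z :&: F) = set0.
  move=> yz; apply/setP=> s; rewrite !inE; apply: contraNF yz.
  by case/andP=> /andP[/rcoset_eqP <- _] /andP[/rcoset_eqP <- _].
have d12 := disj 1 x; have d13 := disj 1 (x * g); have d23 := disj x (x * g).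
rewrite !rcosetM !mulg1 in d12 d13 d23.
have nGx' : gval G != G :* x by apply: contraNneq nGx => ->; apply: rcoset_refl.
have nGxg : gval G != G :* x :* g.
  apply: contraNneq nGx => eqG; have : 1 \in G :* x :* g by rewrite -eqG group1.
  by rewrite !mem_rcoset mul1g groupMl ?groupV.
have /subset_leq_card : (G :&: F) :|: (G :* x :&: F) :|: (G :* x :* g :&: F) \subset F.
  by rewrite !subUset !subsetIr.
rewrite cardsU setIUl d13 // d23 1?eq_sym // setU0 cards0 cardsU d12 // cards0.
by rewrite cardF1 cardF2 cardF3 D9.
Qed.

(** Otherwise [G] is the alternating group and the coset consists of the permutations with the
    parity of [x]; it would contain exactly half of the derangements. *)
Lemma Alt_sub_rcoset (n : nat) (G : {group 'S_n}) (x : 'S_n) : 1 < n ->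
    'Alt_('I_n) \subset G ->
    (#|[set s in G :* x | fixed_point_free s]| * #|[set: 'S_n] : G|)%N =
      #|[set s : 'S_n | fixed_point_free s]| ->
  G = [set: 'S_n] :> {set 'S_n}.
Proof.
move=> n1 sAG eqD; apply/eqP; rewrite eqEsubset subsetT /=.
have [sGA | /subsetPn[g Gg]] := boolP (G \subset 'Alt_('I_n)); last first.
  rewrite Alt_even negbK => odd_g; apply/subsetP=> s _.
  have [es | os] := boolP (s \in 'Alt_('I_n)); first exact: (subsetP sAG).
  rewrite -(mulgKV g s) groupMr // (subsetP sAG) //.
  by rewrite Alt_even odd_permM odd_permV odd_g; rewrite Alt_even negbK in os; rewrite os.
have defG : G = 'Alt_('I_n) :> {set _} by apply/eqP; rewrite eqEsubset sGA.
case: (@card_fpf_parity_neq n (odd_perm x) n1).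
rewrite -eqD defG Alt_index ?card_ord // muln2; congr _.*2.
congr #|pred_of_set _|; apply/setP=> s; rewrite !in_set mem_rcoset Alt_even.
by rewrite odd_permM odd_permV; case: (odd_perm s); case: (odd_perm x).
Qed.

Lemma fpf_proportion_rcoset (n : nat) (G : {group 'S_n}) (x : 'S_n) :
    fpf_proportion (G :* x) = fpf_proportion [set: 'S_n] ->
  G = [set: 'S_n] :> {set 'S_n}.
Proof.
move=> eqp; have eqD := fpf_proportion_eq (card_rcoset G x) eqp.
have [n1 | n1] := leqP n 1.
  apply/eqP; rewrite eqEsubset subsetT; apply/subsetP=> s _.
  rewrite (_ : s = 1) ?group1 //; apply/permP=> i; apply: val_inj => /=.
  by move: (ltn_ord i) (ltn_ord (s i)) (ltn_ord ((1 : 'S_n) i)); lia.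
have m_dv : #|[set: 'S_n] : G| %| #|[set s : 'S_n | fixed_point_free s]|.
  by rewrite -eqD dvdn_mull.
have good q : good_prime n q -> ~~ (q %| #|[set: 'S_n] : G|).
  move/good_prime_ndvdn_card_fpf; apply: contraNN => q_m.
  exact: dvdn_trans q_m m_dv.
have [n4 | n4] := eqVneq n 4.
  move: G x eqp eqD m_dv good {n1}; rewrite n4 => G x _ eqD m_dv good.
  have D9 : #|[set s : 'S_4 | fixed_point_free s]| = 9.
    have := card_fpf 4; rewrite /alt_ffact_sum !big_ord_recr big_ord0 /=.
    by move=> [->].
  rewrite D9 in eqD m_dv.
  have /(dvdn_pfactor _ 2 (isT : prime 3))[k] := m_dv.
  have m24 : #|[set: 'S_4] : G| %| 4`! by rewrite -card_Sn -cardsT dvdn_indexg.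
  case: k => [|[|[|]]] // _ idx; last 1 first.
  - by rewrite idx in m24.
  - by apply/eqP; rewrite eqEsubset subsetT -indexg_eq1 idx.
  case: (@fpf_rcoset_index3 G x) => //; apply/eqP.
  by rewrite -(@eqn_pmul2r 3) //; apply/eqP; rewrite -[RHS]eqD idx.
apply: Alt_sub_rcoset eqD => //; apply: good_index_Alt_sub => // n7.
have n3 : 3 <= n by rewrite n7.
(* For [n = 7], take [r = 3]: the modulus [n - r = 4] does not divide [alt_ffact_sum 3 = -2]. *)
apply: contraL m_dv => m4; apply: contraTN isT => D4.
have := dvdn_trans m4 D4; rewrite (dvdn_card_fpf n3); last by rewrite n7.
by case: alt_ffact_sum_small => _ _ -> _.
Qed.

Local Close Scope group_scope.

Theorem theorem1p1 (n : nat) (n_ge1 : 1 <= n)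
    (G : {group 'S_n}) (C : {set 'S_n})
    (C_coset : C \in lcosets G [set: 'S_n] \/ C \in rcosets G [set: 'S_n])
    (same_proportion : fpf_proportion C = fpf_proportion [set: 'S_n]) :
  G = [set: 'S_n] :> {set 'S_n} /\ C = [set: 'S_n].
Proof.
have fullC (H : {group 'S_n}) (x : 'S_n) : C = (H :* x)%g ->
    H = [set: 'S_n] :> {set 'S_n} /\ C = [set: 'S_n].
  move=> defC; have HT : H = [set: 'S_n] :> {set 'S_n}.
    by apply: (fpf_proportion_rcoset (x := x)); rewrite -defC.
  by split=> //; rewrite defC rcoset_id // HT inE.
case: C_coset => [/lcosetsP[x _ defC] | /rcosetsP[x _ /fullC //]].
(* The left coset of [G] by [x] is the right coset by [x] of the conjugate [G :^ x^-1], which has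
   the order of [G]. *)
have [|GT CT] := fullC (G :^ x^-1)%G x.
  rewrite defC; apply/setP=> s.
  by rewrite mem_lcoset mem_rcoset mem_conjg invgK conjgE mulgKV.
split=> //; apply/eqP; rewrite eqEcard subsetT -[#|G|](cardJg G x^-1).
by move: GT => /= ->.
Qed.
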